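(* Let $\mathbf{k}$ be a field, $\Gamma$ a nontrivial ordered abelian group and $K=\mathbf{k}((t^\Gamma))$. Consider the two-sorted structure $(K,\Gamma;v,T)$, where $K$ carries its field structure, $\Gamma$ carries its ordered group structure, $v$ is the valuation $v(f)=\min\operatorname{supp}(f)$ for $f\neq 0$, and $T:K\times\Gamma\to K$ is the truncation map $T(f,\gamma)=f|_\gamma=\sum_{\delta<\gamma}f_\delta t^\delta$. Then $(K,\Gamma;v,T)$ interprets the two-sorted structure $(\mathbb{N},\mathcal{P}(\mathbb{N});+,\in)$.
   Context: $\mathbf{k}((t^\Gamma))$ is the Hahn series field: the set of formal series $f=\sum_{\gamma\in\Gamma}f_\gamma t^\gamma$ with $f_\gamma\in\mathbf{k}$ whose support $\operatorname{supp}(f)=\{\gamma: f_\gamma\neq 0\}$ is well-ordered, with componentwise addition and the usual convolution multiplication. $(\mathbb{N},\mathcal{P}(\mathbb{N});+,\in)$ is the two-sorted structure consisting of $\mathbb{N}=\{0,1,\ldots\}$ with addition, its power set, and the membership relation. *)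

(* Defs.v *)
From HB Require Import structures.
From mathcomp Require Import all_boot all_order all_algebra.
From mathcomp Require Import boolp classical_sets functions cardinality fsbigop.
From mathcomp Require Import wochoice.

Set Implicit Arguments.
Unset Strict Implicit.
Unset Printing Implicit Defensive.

Import Order.TTheory GRing.Theory.

Record signature := Signature {
  sort : Type;
  func : Type;
  fdom : func -> seq sort;
  fcod : func -> sort;
  rel_symb : Type;
  rdom : rel_symb -> seq sort
}.

(* [point C [:: s1; ..; sn]] is C s1 * (.. * (C sn * unit)). *)
Fixpoint point (S : Type) (C : S -> Type) (X : seq S) : Type :=
  if X is s :: X' then (C s * point C X')%type else unit.

Fixpoint point_cat (S : Type) (C : S -> Type) (X Y : seq S) :
    point C X -> point C Y -> point C (X ++ Y) :=
  match X with
  | [::] => fun _ b => b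
  | s :: X' => fun a b => (a.1, point_cat a.2 b)
  end.

Fixpoint point_left (S : Type) (C : S -> Type) (X Y : seq S) :
    point C (X ++ Y) -> point C X :=
  match X with
  | [::] => fun _ => tt
  | s :: X' => fun a => (a.1, point_left a.2)
  end.

Fixpoint point_right (S : Type) (C : S -> Type) (X Y : seq S) :
    point C (X ++ Y) -> point C Y :=
  match X with
  | [::] => fun a => a
  | s :: X' => fun a => point_right a.2
  end.

Record structure (L : signature) := Structure {
  carrier :> sort L -> Type;
  fun_interp : forall f : func L, point carrier (fdom f) -> carrier (fcod f);
  rel_interp : forall r : rel_symb L, point carrier (rdom r) -> Prop
}.

(* Formulas in context: the list indexing [formula] gives the sorts of the
   free variables, which are well-sorted de Bruijn indices. *)
Inductive var (S : Type) : seq S -> S -> Type :=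
| VarO (s : S) (X : seq S) : var (s :: X) s
| VarS (s s' : S) (X : seq S) : var X s -> var (s' :: X) s.

Inductive term (L : signature) (X : seq (sort L)) : sort L -> Type :=
| TVar (s : sort L) : var X s -> term X s
| TApp (f : func L) : terms X (fdom f) -> term X (fcod f)
with terms (L : signature) (X : seq (sort L)) : seq (sort L) -> Type :=
| TNil : terms X [::]
| TCons (s : sort L) (Y : seq (sort L)) :
    term X s -> terms X Y -> terms X (s :: Y).

Inductive formula (L : signature) : seq (sort L) -> Type :=
| FEq (X : seq (sort L)) (s : sort L) : term X s -> term X s -> formula X
| FRel (X : seq (sort L)) (r : rel_symb L) : terms X (rdom r) -> formula X
| FNot (X : seq (sort L)) : formula X -> formula X
| FAnd (X : seq (sort L)) : formula X -> formula X -> formula X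
| FOr (X : seq (sort L)) : formula X -> formula X -> formula X
| FImp (X : seq (sort L)) : formula X -> formula X -> formula X
| FEx (X : seq (sort L)) (s : sort L) : formula (s :: X) -> formula X
| FAll (X : seq (sort L)) (s : sort L) : formula (s :: X) -> formula X.

Fixpoint lookup (S : Type) (C : S -> Type) (X : seq S) (s : S)
    (x : var X s) : point C X -> C s :=
  match x in var X s return point C X -> C s with
  | VarO s X => fun e => e.1
  | VarS s s' X y => fun e => lookup y e.2
  end.

Fixpoint eval_term (L : signature) (M : structure L) (X : seq (sort L))
    (e : point M X) (s : sort L) (t : term X s) : M s :=
  match t in term _ s return M s with
  | TVar s x => lookup x e
  | TApp f ts => fun_interp (eval_terms e ts)
  end
with eval_terms (L : signature) (M : structure L) (X : seq (sort L))
    (e : point M X) (Y : seq (sort L)) (ts : terms X Y) : point M Y :=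
  match ts in terms _ Y return point M Y with
  | TNil => tt
  | TCons s Y t ts' => (eval_term e t, eval_terms e ts')
  end.

Fixpoint sat (L : signature) (M : structure L) (X : seq (sort L))
    (phi : formula X) : point M X -> Prop :=
  match phi in formula X return point M X -> Prop with
  | FEq X s t u => fun e => eval_term e t = eval_term e u
  | FRel X r ts => fun e => rel_interp (eval_terms e ts)
  | FNot X p => fun e => ~ sat p e
  | FAnd X p q => fun e => sat p e /\ sat q e
  | FOr X p q => fun e => sat p e \/ sat q e
  | FImp X p q => fun e => sat p e -> sat q e
  | FEx X s p => fun e => exists a : M s, @sat L M (s :: X) p (a, e)
  | FAll X s p => fun e => forall a : M s, @sat L M (s :: X) p (a, e)
  end.

(* Definable means definable with parameters: [a] is the tuple of
   parameters. *)
Definition definable (L : signature) (M : structure L) (X : seq (sort L))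
    (A : set (point M X)) : Prop :=
  exists (P : seq (sort L)) (a : point M P) (phi : formula (X ++ P)),
    forall x : point M X, A x <-> sat phi (point_cat x a).

Fixpoint codes (L L' : signature) (M : structure L) (N : structure L')
    (w : sort L' -> seq (sort L))
    (code : forall s : sort L', point M (w s) -> N s -> Prop)
    (Y : seq (sort L')) :
    point M (flatten [seq w s | s <- Y]) -> point N Y -> Prop :=
  match Y return point M (flatten [seq w s | s <- Y]) -> point N Y -> Prop with
  | [::] => fun _ _ => True
  | s :: Y' => fun x y =>
      code s (point_left x) y.1 /\ codes code (point_right x) y.2
  end.

Definition pullback (L L' : signature) (M : structure L) (N : structure L')
    (w : sort L' -> seq (sort L))
    (code : forall s : sort L', point M (w s) -> N s -> Prop)
    (Y : seq (sort L')) (R : set (point N Y)) :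
    set (point M (flatten [seq w s | s <- Y])) :=
  [set x | exists2 y, codes code x y & R y].

(* For each sort s of N, [code s] is the graph of a surjection onto N s from
   the set of tuples of M, with sorts [w s], that code an element of N s.
   This set, and the pullbacks of equality, of the graphs of the functions of N
   and of the relations of N, are definable in M. *)
Definition interprets (L L' : signature) (M : structure L) (N : structure L')
    : Prop :=
  exists (w : sort L' -> seq (sort L))
         (code : forall s : sort L', point M (w s) -> N s -> Prop),
    (forall s x y z, code s x y -> code s x z -> y = z) /\
    (forall s y, exists x, code s x y) /\
    (forall s, definable (fun x => exists y, code s x y)) /\
    (forall s, definable
      (pullback code (Y := [:: s; s]) (fun y => y.1 = y.2.1))) /\
    (forall f : func L', definable
      (pullback code (Y := fcod f :: fdom f)
         (fun y => y.1 = fun_interp y.2))) /\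
    (forall r : rel_symb L', definable
      (pullback code (Y := rdom r) (fun y => rel_interp y))).

Local Open Scope classical_set_scope.
Local Open Scope ring_scope.

HB.mixin Record isOrderedAbelianGroup G of Num.POrderedZmodule G := {
  oag_total : total (<=%R : rel G);
  oag_leD2r : forall z x y : G, x <= y -> x + z <= y + z
}.

#[short(type="oagType")]
HB.structure Definition OrderedAbelianGroup :=
  { G of Num.POrderedZmodule G & isOrderedAbelianGroup G }.

Section OagTheory.
Variable G : oagType.
Implicit Types x y z : G.

Lemma oag_comparable x y : x >=< y.
Proof. exact: oag_total. Qed.

Lemma oag_ltNge x y : (x < y) = ~~ (y <= x).
Proof. exact: comparable_ltNge (oag_comparable x y). Qed.

Lemma oag_leNgt x y : (x <= y) = ~~ (y < x).
Proof. exact: comparable_leNgt (oag_comparable x y). Qed.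

Lemma oag_le2r z x y : (x + z <= y + z) = (x <= y).
Proof.
apply/idP/idP => [/(oag_leD2r (- z))|]; first by rewrite !addrK.
exact: oag_leD2r.
Qed.

Lemma oag_le2l z x y : (z + x <= z + y) = (x <= y).
Proof. by rewrite ![z + _]addrC oag_le2r. Qed.

Lemma oag_lt2l z x y : (z + x < z + y) = (x < y).
Proof. by rewrite !oag_ltNge oag_le2l. Qed.

Lemma oag_lt2r z x y : (x + z < y + z) = (x < y).
Proof. by rewrite !oag_ltNge oag_le2r. Qed.

Lemma oag_leN2 x y : (- x <= - y) = (y <= x).
Proof. by rewrite -(oag_le2r (x + y) (- x)) addKr [x + y]addrC addKr. Qed.

Definition has_mins (A : set G) : Prop :=
  forall B : set G, (B `<=` A) -> (B !=set0) ->
    exists2 m, B m & forall x, B x -> m <= x.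

Lemma wo_chain_has_mins (C : {pred G}) :
  wo_chain <=%R C <-> has_mins [set x | x \in C].
Proof.
split=> [woC B sBC [b Bb]|minC A sAC [a Aa]].
  have [x|//|m [[mB lem] _]] := woC [pred x | `[< B x >]].
  - by move=> /asboolP Bx; exact: sBC Bx.
  - by exists b; apply/asboolP.
  exists m; first exact/asboolP.
  by move=> x Bx; apply: lem; apply/asboolP.
have [|//|m Am lem] := minC [set x | x \in A]; [by move=> x /sAC | by exists a|].
exists m; split; first by split.
move=> n [An len]; apply/le_anti; rewrite len //.
by rewrite lem.
Qed.

Lemma has_minsS (A B : set G) : (A `<=` B) -> has_mins B -> has_mins A.
Proof. by move=> sAB mB C sCA; apply: mB; apply: subset_trans sAB. Qed.

Lemma has_minsU (A B : set G) :
  has_mins A -> has_mins B -> has_mins (A `|` B).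
Proof.
move=> mA mB C sC [c Cc].
have [[a [Ca Aa]]|nA] := pselect (exists a, C a /\ A a); last first.
  apply: mB; last by exists c.
  by move=> x Cx; case: (sC x Cx) => // Ax; case: nA; exists x.
have [[b [Cb Bb]]|nB] := pselect (exists b, C b /\ B b); last first.
  apply: mA; last by exists c.
  by move=> x Cx; case: (sC x Cx) => // Bx; case: nB; exists x.
have [|//|m [Cm Am] lem] := mA (C `&` A); first by move=> ? [].
  by exists a.
have [|//|n [Cn Bn] len] := mB (C `&` B); first by move=> ? [].
  by exists b.
have [lemn|lenm] := orP (oag_total m n).
  exists m => // x Cx; case: (sC x Cx) => [Ax|Bx]; first exact: lem.
  exact: le_trans (len _ _).
exists n => // x Cx; case: (sC x Cx) => [Ax|Bx]; last exact: len.
exact: le_trans (lem _ _).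
Qed.

Lemma has_minsD (A B : set G) : has_mins A -> has_mins B ->
  has_mins [set a + b | a in A & b in B].
Proof.
move=> mA mB C sC C0; apply: contrapT => nminC.
pose bad (D : set G) := [/\ (D `<=` C), (D !=set0) &
  forall m, D m -> exists2 x, D x & x < m].
pose least (D : set G) a b := [/\ A a, B b, D (a + b),
  forall a' b', A a' -> B b' -> D (a' + b') -> a <= a' &
  forall b', B b' -> D (a + b') -> b <= b'].
have leastP D : bad D -> exists a b, least D a b.
  case=> sD [d Dd] _.
  have [a0 Aa0 [b0 Bb0 d0]] := sC d (sD d Dd).
  have [|//|a [Aa [b1 Bb1 Db1]] lea] :=
    mA [set a | A a /\ exists2 b, B b & D (a + b)].
  - by move=> x [].
  - by exists a0; split=> //; exists b0 => //; rewrite d0.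
  have [|//|b [Bb Dab] leb] := mB [set b | B b /\ D (a + b)].
  - by move=> x [].
  - by exists b1.
  exists a, b; split=> // [a' b' Aa' Bb' Dab'|b' Bb' Dab'].
    by apply: lea; split=> //; exists b'.
  by apply: leb.
have badC : bad C.
  split=> // m Cm; apply: contrapT => nx; apply: nminC; exists m => // x Cx.
  by rewrite oag_leNgt; apply/negP => ltxm; apply: nx; exists x.
have [|//|b [Bb [D [badD [a lab]]]] leb] :=
  mB [set b | B b /\ exists D, bad D /\ exists a, least D a b].
- by move=> x [].
- have [a [b lab]] := leastP C badC.
  by exists b; split; [case: lab | exists C; split=> //; exists a].
have [sD D0 Dlt] := badD; have [Aa _ Dab lea leb'] := lab.
pose D1 := [set x | D x /\ x < a + b].
have badD1 : bad D1.
  split=> [x [/sD]//||m [Dm ltm]].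
    by have [x Dx ltx] := Dlt _ Dab; exists x.
  by have [x Dx ltx] := Dlt _ Dm; exists x => //; split=> //; exact: lt_trans ltm.
have [a1 [b1 lab1]] := leastP _ badD1.
have [Aa1 Bb1 [Dab1 lt1] _ _] := lab1.
have lea1 : a <= a1 := lea _ _ Aa1 Bb1 Dab1.
have leb1 : b <= b1 by apply: leb; split=> //; exists D1; split=> //; exists a1.
have : a + b <= a1 + b1.
  by apply: (@le_trans _ _ (a1 + b)); rewrite ?oag_le2r ?oag_le2l.
by rewrite oag_leNgt lt1.
Qed.

Lemma has_mins_finite (S : set G) : has_mins S ->
  (forall B : set G, (B `<=` S) -> (B !=set0) ->
     exists2 m, B m & forall x, B x -> x <= m) ->
  finite_set S.
Proof.
move=> minS maxS; apply: contrapT => infS.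
pose I u := [set x | S x /\ x <= u].
have S0 : (S !=set0).
  by apply/set0P/eqP => S0; apply: infS; rewrite S0.
have [m Sm lem] := maxS S (fun x h => h) S0.
have [|//|u [Su infu] leu] := minS [set u | S u /\ ~ finite_set (I u)].
- by move=> x [].
- exists m; split=> // finI; apply: infS; apply: sub_finite_set finI => x Sx.
  by split=> //; apply: lem.
have [[p0 [Sp0 ltp0]]|nlt] := pselect (exists x, S x /\ x < u); last first.
  apply: infu; apply: (@sub_finite_set _ _ [set u]) => // x [Sx lexu].
  apply: contrapT => xu; apply: nlt; exists x; split=> //.
  by rewrite lt_neqAle lexu andbT; apply/eqP.
have [|//|p [Sp ltpu] lep] := maxS [set x | S x /\ x < u].
- by move=> x [].
- by exists p0.
have finp : finite_set (I p).
  by apply: contrapT => infp; have := leu p (conj Sp infp); rewrite oag_leNgt ltpu.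
apply: infu; apply: (@sub_finite_set _ _ (I p `|` [set u])).
  move=> x [Sx]; rewrite le_eqVlt => /orP[/eqP-> | ltxu]; [by right | left].
  by split=> //; apply: lep.
by rewrite finite_setU; split.
Qed.

End OagTheory.

Section HahnSeries.
Variables (k : fieldType) (G : oagType).
Implicit Types f g : G -> k.

Definition supp f : {pred G} := [pred c | f c != 0].

Definition wo_supported : {pred G -> k} :=
  fun f => `[< wo_chain <=%R (supp f) >].

Lemma wo_supportedP f :
  reflect (has_mins [set c | f c != 0]) (f \in wo_supported).
Proof. by apply: (equivP (asboolP _)); apply: wo_chain_has_mins. Qed.

Lemma wo_supported_zmod : zmod_closed wo_supported.
Proof.
split=> [|f g /wo_supportedP mf /wo_supportedP mg]; apply/wo_supportedP.
  by move=> B sB [x /sB] /=; rewrite eqxx.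
apply: has_minsS (has_minsU mf mg) => c /= fgc.
have [fc0|] := eqVneq (f c) 0; last by left.
by right; apply: contra_neq fgc => gc0; rewrite addrfctE opprfctE /= fc0 gc0 subrr.
Qed.

HB.instance Definition _ := GRing.isZmodClosed.Build (G -> k) wo_supported
  wo_supported_zmod.

Record hahn := Hahn { coef :> G -> k; _ : coef \in wo_supported }.

HB.instance Definition _ := [isSub for coef].
HB.instance Definition _ := [Choice of hahn by <:].
HB.instance Definition _ := [SubChoice_isSubZmodule of hahn by <:].

Lemma hahnP (f : hahn) : has_mins [set c | f c != 0].
Proof. by apply/wo_supportedP; case: f. Qed.

Lemma coefD (f g : hahn) c : (f + g) c = f c + g c.
Proof. by []. Qed.

Lemma coefN (f : hahn) c : (- f) c = - f c.
Proof. by []. Qed.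

Lemma coef0 c : (0 : hahn) c = 0.
Proof. by []. Qed.

Definition one_coef : G -> k := fun c => if c == 0 then 1 else 0.

Lemma one_coefP : one_coef \in wo_supported.
Proof.
apply/wo_supportedP => B sB [b Bb].
have B0 x : B x -> x = 0.
  by move/sB => /=; rewrite /one_coef; case: (eqVneq x 0) => //; rewrite eqxx.
by exists b => // x Bx; rewrite (B0 _ Bx) (B0 _ Bb).
Qed.

Definition hahn_one : hahn := Hahn one_coefP.

(* The sum is finite, by [mul_coef_finite]. *)
Definition mul_coef f g : G -> k :=
  fun c => \sum_(a \in [set: G]) f a * g (c - a).

Lemma mul_coef_finite (f g : hahn) c :
  finite_set [set a | f a * g (c - a) != 0].
Proof.
have fg a : f a * g (c - a) != 0 -> f a != 0 /\ g (c - a) != 0.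
  by rewrite mulf_eq0 negb_or => /andP.
apply: has_mins_finite => [|B sB [b Bb]].
  by apply: has_minsS (@hahnP f) => a /fg[].
have [|//|m Bm lem] := @hahnP g ( [set d | B (c - d)]).
- by move=> d /sB/fg[_]; rewrite /= subKr.
- by exists (c - b); rewrite /= subKr.
exists (c - m) => // x Bx; have := lem (c - x).
rewrite /= subKr => /(_ Bx) lem'.
by rewrite -(oag_le2r (m - x)) [x + _]addrC subrK addrA subrK.
Qed.

Lemma mul_coefP (f g : hahn) : mul_coef f g \in wo_supported.
Proof.
apply/wo_supportedP; apply: has_minsS (has_minsD (@hahnP f) (@hahnP g)) => c /= fgc.
apply: contrapT => nc; case/eqP: fgc; apply: fsbig1 => a _.
apply: contrapT => /eqP; rewrite mulf_eq0 negb_or => /andP[fa gca].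
by apply: nc; exists a => //; exists (c - a) => //; rewrite addrC subrK.
Qed.

Definition hahn_mul (f g : hahn) : hahn := Hahn (mul_coefP f g).

Definition trunc_coef f (c : G) : G -> k := fun d => if d < c then f d else 0.

Lemma trunc_coefP (f : hahn) c : trunc_coef f c \in wo_supported.
Proof.
apply/wo_supportedP; apply: has_minsS (@hahnP f) => d /=.
by rewrite /trunc_coef; case: ifP; rewrite ?eqxx.
Qed.

Definition trunc (f : hahn) (c : G) : hahn := Hahn (trunc_coefP f c).

(* The graph of the valuation, which is not defined at 0. *)
Definition valuation_graph (f : hahn) (c : G) : Prop :=
  f != 0 /\ minimum_of <=%R (supp f) c.

End HahnSeries.

Variant vt_sort := SK | SG.

Variant vt_func := K0 | K1 | Kadd | Kopp | Kmul | G0 | Gadd | Gopp | FT.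

Variant vt_rel := Gle | Rv.

(* Inverses and subtraction are definable from the ring operations.
   The valuation is a partial function on K, so it is given by a relation
   symbol, interpreted by its graph. *)
Definition vt_signature : signature := {|
  sort := vt_sort;
  func := vt_func;
  fdom := fun f => match f with
    | K0 | K1 | G0 => [::]
    | Kadd | Kmul => [:: SK; SK]
    | Kopp => [:: SK]
    | Gadd => [:: SG; SG]
    | Gopp => [:: SG]
    | FT => [:: SK; SG]
    end;
  fcod := fun f => match f with
    | K0 | K1 | Kadd | Kopp | Kmul | FT => SK
    | G0 | Gadd | Gopp => SG
    end;
  rel_symb := vt_rel;
  rdom := fun r => match r with
    | Gle => [:: SG; SG]
    | Rv => [:: SK; SG]
    end
|}.

Definition hahn_carrier (k : fieldType) (G : oagType) (s : vt_sort) : Type :=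
  match s with SK => hahn k G | SG => G end.

Definition hahn_structure (k : fieldType) (G : oagType) :
    structure vt_signature :=
  @Structure vt_signature (hahn_carrier k G)
    (fun f => match f return
       point (hahn_carrier k G) (fdom (s := vt_signature) f) ->
       hahn_carrier k G (fcod (s := vt_signature) f) with
     | K0 => fun _ => (0 : hahn k G)
     | K1 => fun _ => hahn_one k G
     | Kadd => fun x => (x.1 : hahn k G) + x.2.1
     | Kopp => fun x => - (x.1 : hahn k G)
     | Kmul => fun x => hahn_mul x.1 x.2.1
     | G0 => fun _ => (0 : G)
     | Gadd => fun x => (x.1 : G) + x.2.1
     | Gopp => fun x => - (x.1 : G)
     | FT => fun x => trunc x.1 x.2.1
     end)
    (fun r => match r return
       point (hahn_carrier k G) (rdom (s := vt_signature) r) -> Prop with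
     | Gle => fun x => (x.1 : G) <= x.2.1
     | Rv => fun x => valuation_graph x.1 x.2.1
     end).

Variant np_sort := SN | SP.
Variant np_func := Nadd.
Variant np_rel := Nmem.

Definition np_signature : signature := {|
  sort := np_sort;
  func := np_func;
  fdom := fun _ => [:: SN; SN];
  fcod := fun _ => SN;
  rel_symb := np_rel;
  rdom := fun _ => [:: SN; SP]
|}.

Definition nat_carrier (s : np_sort) : Type :=
  match s with SN => nat | SP => set nat end.

Definition nat_structure : structure np_signature :=
  @Structure np_signature nat_carrier
    (fun (_ : np_func) (x : nat * (nat * unit)) => (x.1 + x.2.1)%N)
    (fun (_ : np_rel) (x : nat * (set nat * unit)) => x.2.1 x.1).

(* Main.v *)
Require Import Defs.
From mathcomp Require Import all_boot all_order all_algebra.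
From mathcomp Require Import boolp classical_sets wochoice.

(** Fix c > 0 in Γ.  The support of a series is uniformly definable: γ lies in
    supp g if and only if v(g - T(g, γ)) = γ.  Hence the copy {n c : n ∈ ℕ} of
    (ℕ, +) inside Γ is definable as the support of the parameter ∑ t^(n c).  It
    is well-ordered, so each of its subsets is the support of a series, and a
    series g can code the set {n : n c ∈ supp g}. *)

Set Implicit Arguments.
Unset Strict Implicit.
Unset Printing Implicit Defensive.

Import Order.TTheory GRing.Theory.

Local Open Scope ring_scope.

Section PositiveMultiples.
Variables (k : fieldType) (G : oagType) (c : G).
Hypothesis c_gt0 : 0 < c.

Lemma oag_mulrn_mono : {mono GRing.natmul c : m n / (m <= n)%N >-> m <= n}.
Proof.
apply: (@le_mono _ _ nat G); apply: homo_ltn => [y x z|n]; first exact: lt_trans.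
by rewrite mulrSr -{1}[c *+ n]addr0 oag_lt2l.
Qed.

Lemma oag_mulrn_inj : injective (GRing.natmul c).
Proof.
by move=> m n e; apply/eqP; rewrite eqn_leq -!oag_mulrn_mono e lexx.
Qed.

(** The coefficients of $\sum_{n \in A} t^{nc}$. *)
Definition multiples_coef (A : set nat) : G -> k :=
  fun d => if `[< exists2 n, A n & d = c *+ n >] then 1 else 0.

Lemma multiples_coef_neq0 A d :
  multiples_coef A d != 0 <-> exists2 n, A n & d = c *+ n.
Proof.
rewrite /multiples_coef; case: asboolP => h; first by rewrite oner_eq0.
by rewrite eqxx.
Qed.

(** Since [c] is positive, $n \mapsto nc$ preserves order, so the least $n$ with $nc \in B$ gives
    the minimum of [B]. *)
Lemma multiples_coefP A : multiples_coef A \in @wo_supported k G.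
Proof.
apply/wo_supportedP => B sB [b Bb].
have exB : exists n, `[< B (c *+ n) >].
  have [n _ bE] := (multiples_coef_neq0 A b).1 (sB _ Bb).
  by exists n; apply/asboolP; rewrite -bE.
have [m /asboolP Bm minm] := ex_minnP exB.
exists (c *+ m) => // x Bx.
have [n _ xE] := (multiples_coef_neq0 A x).1 (sB _ Bx).
by rewrite xE oag_mulrn_mono; apply: minm; rewrite -xE; apply/asboolP.
Qed.

Definition multiples_series A : hahn k G := Hahn (multiples_coefP A).

Lemma multiples_series_mulrn A n : multiples_series A (c *+ n) != 0 <-> A n.
Proof.
rewrite multiples_coef_neq0; split=> [[m Am /oag_mulrn_inj->] //|An].
by exists n.
Qed.

Lemma multiples_series_setT d :
  multiples_series setT d != 0 <-> exists n, d = c *+ n.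
Proof.
rewrite multiples_coef_neq0.
by split=> [[n _ dE]|[n dE]]; exists n.
Qed.

End PositiveMultiples.

(** Subtracting the truncation deletes exactly the terms with exponent below [d]. What remains has
    no exponent smaller than [d], so its valuation is [d] precisely when the term at [d] is
    present. *)
Lemma valuation_graph_subr_trunc (k : fieldType) (G : oagType)
    (g : hahn k G) (d : G) :
  valuation_graph (g - trunc g d) d <-> g d != 0.
Proof.
have gE e : (g - trunc g d) e = if e < d then 0 else g e.
  rewrite Defs.coefD Defs.coefN /= /trunc_coef.
  by case: ifP; rewrite ?subrr ?subr0.
have suppE e : (e \in supp (g - trunc g d)) = ((g - trunc g d) e != 0) by [].
split=> [[_ [dsupp _]]|gd0]; first by move: dsupp; rewrite suppE gE ltxx.
have dsupp : (g - trunc g d) d != 0 by rewrite gE ltxx.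
split; first by apply: contra_neq dsupp => ->.
split=> // e; rewrite suppE gE oag_leNgt.
by case: ifP => //; rewrite eqxx.
Qed.

Definition supp_formula (X : seq vt_sort) (g : term (L := vt_signature) X SK)
    (d : term (L := vt_signature) X SG) : formula (L := vt_signature) X :=
  @FRel vt_signature X Rv
    (TCons (@TApp vt_signature X Kadd
      (TCons g (TCons (@TApp vt_signature X Kopp
        (TCons (@TApp vt_signature X FT (TCons g (TCons d (TNil _))))
          (TNil _))) (TNil _))))
      (TCons d (TNil _))).

Lemma sat_supp_formula (k : fieldType) (G : oagType) (X : seq vt_sort)
    (e : Defs.point (hahn_structure k G) X) g d :
  sat (supp_formula g d) e
    <-> coef (eval_term e g : hahn k G) (eval_term e d : G) != 0.
Proof. exact: valuation_graph_subr_trunc. Qed.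

Definition nat_width (s : np_sort) : seq vt_sort :=
  match s with SN => [:: SG] | SP => [:: SK] end.

(** Coefficients at exponents other than the multiples of [c] are ignored. Thus every series codes a
    set, and many series code the same one. *)
Definition nat_code (k : fieldType) (G : oagType) (c : G) (s : np_sort) :
    Defs.point (hahn_structure k G) (nat_width s) -> nat_structure s -> Prop :=
  match s return
    Defs.point (hahn_structure k G) (nat_width s) -> nat_structure s -> Prop with
  | SN => fun x n => x.1 = c *+ n
  | SP => fun x A => forall n, A n <-> coef (x.1 : hahn k G) (c *+ n) != 0
  end.

Notation v0 := (@TVar vt_signature _ _ (VarO _ _)).
Notation v1 := (@TVar vt_signature _ _ (VarS _ (VarO _ _))).
Notation v2 := (@TVar vt_signature _ _ (VarS _ (VarS _ (VarO _ _)))).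
Notation v3 := (@TVar vt_signature _ _ (VarS _ (VarS _ (VarS _ (VarO _ _))))).

Theorem theorem5p3 (k : fieldType) (G : oagType)
  (G_nontrivial : exists c : G, c != 0) :
  interprets (hahn_structure k G) nat_structure.
Proof.
have [c c_gt0] : exists c : G, 0 < c.
  have [c c0] := G_nontrivial.
  have [lec|lec] := orP (oag_total 0 c).
    by exists c; rewrite lt_neqAle eq_sym c0.
  by exists (- c); rewrite lt_neqAle eq_sym oppr_eq0 c0 -oppr0 oag_leN2.
pose f := multiples_series k c_gt0 setT.
have fP d : coef f d != 0 <-> exists n, d = c *+ n.
  exact: multiples_series_setT.
pose coded (g : hahn k G) : set nat := fun n => g (c *+ n) != 0.
exists nat_width, (@nat_code k G c); do ![split].
- case=> [x m n xm xn|x A B xA xB].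
    by apply: (oag_mulrn_inj c_gt0); rewrite -xm -xn.
  by apply/funext => n; apply/propext; rewrite xA xB.
- case=> [n|A]; first by exists (c *+ n, tt).
  by exists (multiples_series k c_gt0 A, tt) => n; rewrite multiples_series_mulrn.
- case.
    (* Parameters follow the arguments in the context, so [f] is always the variable of highest
       index, here [v1]. *)
    exists [:: SK], (f, tt), (supp_formula v1 v0) => x.
    by rewrite sat_supp_formula fP.
  (* A tautology defines the domain, which is all of $K$. *)
  exists [::], tt, (FEq v0 v0) => x; split=> // _.
  by exists (coded x.1).
- case.
    exists [:: SK], (f, tt), (FAnd (FEq v0 v1) (supp_formula v2 v0)).
    case=> x [y []]; cbn [sat]; rewrite sat_supp_formula fP /=.
    split=> [[[m [n []]] /= [xm [yn _]] mn]|[/= <- [n xn]]].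
      by rewrite xm yn mn; split=> //; exists n.
    by exists (n, (n, tt)).
  (* Two series code the same set when their supports agree on the multiples of [c]. Here [v0] is
     the bound exponent, [v1] and [v2] are the two series, and the guard on [v3], that is [f],
     restricts [v0] to these multiples. *)
  exists [:: SK], (f, tt),
    (@FAll vt_signature _ SG (FImp (supp_formula v3 v0)
       (FAnd (FImp (supp_formula v1 v0) (supp_formula v2 v0))
             (FImp (supp_formula v2 v0) (supp_formula v1 v0))))).
  case=> x [y []]; cbn [sat].
  split=> [[[A [B []]] [xA [yB _]] AB] d|xy].
    rewrite !sat_supp_formula fP => -[n ->] /=.
    by rewrite -xA -yB AB.
  (* The set read off from [x] serves for both series; it remains to see that [y] codes it too. *)
  exists (coded x, (coded x, tt)) => //.
  split=> //; split=> // n.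
  have := xy (c *+ n); rewrite !sat_supp_formula fP.
  by case=> [|xyn yxn]; [exists n | split].
(* The value of the sum comes first, as [v0]. Only the summands are required to lie in the support
   of [f]; their sum is then a multiple of [c]. *)
- case; exists [:: SK], (f, tt),
    (FAnd (FEq v0 (@TApp vt_signature _ Gadd (TCons v1 (TCons v2 (TNil _)))))
      (FAnd (supp_formula v3 v1) (supp_formula v3 v2))).
  case=> x [y [z []]]; cbn [sat]; rewrite !sat_supp_formula !fP /=.
  split=> [[[l [m [n []]]] /= [xl [ym [zn _]]] lmn]|[-> [[m ->] [n ->]]]].
    rewrite xl ym zn lmn mulrnDr.
    by split=> //; split; [exists m | exists n].
  by exists ((m + n)%N, (m, (n, tt))); rewrite //= mulrnDr.
(* Membership of $n$ in the set coded by [v1] says that the exponent $nc$, here [v0], lies in the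
   support of [v1]. *)
- case; exists [:: SK], (f, tt),
    (FAnd (supp_formula v2 v0) (supp_formula v1 v0)).
  case=> x [y []]; cbn [sat]; rewrite !sat_supp_formula fP /=.
  split=> [[[n [A []]] /= [xn [yA _]] An]|[[n xn] yn]].
    by split; [exists n | rewrite xn -yA].
  exists (n, (coded y, tt)) => /=.
    by split.
  by rewrite /coded -xn.
Qed.
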